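(* Let $p\geq 2$ be an integer and let $a_0,\ldots,a_{p-1},b_0,\ldots,b_{p-1}$ be integers such that $p \mid i a_i + b_i$ and $\gcd(a_i,p)=1$ for each $i\in\{0,\ldots,p-1\}$, and let $f$ be defined by $f(n)=(a_i n+b_i)/p$ whenever $n\equiv i \pmod p$. For every $k\geq1$, the graphs $C^{(f)}(p,k)$ and $B(p,k)$ are isomorphic, and the map $\Phi^{(f)}_{p,k}:\{0,\ldots,p^k-1\}\to\{0,\ldots,p^k-1\}$, $\Phi^{(f)}_{p,k}(n)=\sum_{i=0}^{k-1}x^{(f)}_i(n)\,p^i$, is an isomorphism from $C^{(f)}(p,k)$ to $B(p,k)$. Furthermore, the graphs $C^{(f)}(\mathbb{Z}_p)$ and $B(\mathbb{Z}_p)$ are isomorphic, and the map $\Phi^{(f)}_p:\mathbb{Z}_p\to\mathbb{Z}_p$, $\Phi^{(f)}_p(n)=\sum_{i=0}^{\infty}x^{(f)}_i(n)\,p^i$, is an isomorphism from $C^{(f)}(\mathbb{Z}_p)$ to $B(\mathbb{Z}_p)$ satisfying $f=(\Phi^{(f)}_p)^{-1}\circ\sigma_p\circ\Phi^{(f)}_p$.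
   Context: All graphs are directed. $\mathbb{Z}_p$ denotes the $p$-adic integers (inverse limit of $\mathbb{Z}/p^k\mathbb{Z}$); $f$ is defined on $\mathbb{Z}$ and extended to $\mathbb{Z}_p$ by the same formula. Let $x^{(f)}_i(n)\in\{0,\ldots,p-1\}$ be defined by $x^{(f)}_i(n)\equiv f^i(n)\pmod p$, where $f^0(n)=n$ and $f^{j+1}=f\circ f^j$. $C^{(f)}(p,k)$ is the graph with vertex set $\{0,\ldots,p^k-1\}$ and an edge from $u$ to $v$ iff there exist integers $u_1\equiv u$, $v_1\equiv v\pmod{p^k}$ with $f(u_1)=v_1$. $C^{(f)}(\mathbb{Z}_p)$ has vertex set $\mathbb{Z}_p$ and edges $n\to f(n)$. The $p$-ary De Bruijn graph $B(p,k)$ has vertex set $\{0,\ldots,p^k-1\}$, a number $\sum_{i=0}^{k-1}c_ip^i$ ($c_i\in\{0,\ldots,p-1\}$) identified with the word $c_0c_1\cdots c_{k-1}$, and an edge from $a_0\cdots a_{k-1}$ to $c_0\cdots c_{k-1}$ iff $a_{i+1}=c_i$ for $i=0,\ldots,k-2$. The shift map $\sigma_p:\mathbb{Z}_p\to\mathbb{Z}_p$ is $\sigma_p(n)=(n-d)/p$ where $d\in\{0,\ldots,p-1\}$, $d\equiv n\pmod p$; $B(\mathbb{Z}_p)$ is the graph with vertex set $\mathbb{Z}_p$ and edges $n\to\sigma_p(n)$. *)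

(* Defs.v *)
From HB Require Import structures.
From mathcomp Require Import all_boot all_order all_algebra.
From mathcomp Require Import boolp classical_sets.

Set Implicit Arguments.
Unset Strict Implicit.
Unset Printing Implicit Defensive.

Import Order.TTheory GRing.Theory Num.Theory.
Local Open Scope ring_scope.

Record digraph := Digraph { vertex :> Type; edge : vertex -> vertex -> Prop }.

Definition digraph_iso (G H : digraph) (phi : G -> H) : Prop :=
  bijective phi /\ forall u v : G, edge u v <-> edge (phi u) (phi v).

Definition isomorphic (G H : digraph) : Prop :=
  exists phi : G -> H, digraph_iso phi.

(* The inverse limit of the rings Z/p^kZ, for an arbitrary (not necessarily
   prime) p: res x k is the representative in {0, ..., p^k - 1} of the image of
   x in Z/p^kZ. *)
Record padic (p : nat) := Padic {
  res : nat -> int;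
  res_coherent : forall k, res k = (res k.+1 %% p%:Z ^+ k)%Z }.

HB.instance Definition _ (p : nat) := gen_eqMixin (padic p).
HB.instance Definition _ (p : nat) := gen_choiceMixin (padic p).

Section PadicRing.
Variable p : nat.
Implicit Types x y z : padic p.

Lemma padicP x y : (forall k, res x k = res y k) -> x = y.
Proof.
case: x y => [r rP] [s sP] /= /funext E; case: s / E sP => sP.
by congr Padic; apply: Prop_irrelevance.
Qed.

Lemma res_mod x k : (res x k %% p%:Z ^+ k)%Z = res x k.
Proof. by rewrite res_coherent modz_mod. Qed.

Lemma modz_expSm (m : int) k :
  ((m %% p%:Z ^+ k.+1)%Z = m %[mod p%:Z ^+ k])%Z.
Proof.
by rewrite [(m %% p%:Z ^+ k.+1)%Z]/modz exprS -mulNr mulrA addrC modzMDl.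
Qed.

Lemma padic_reduce_subproof (s : nat -> int) :
  (forall k, (s k.+1 = s k %[mod p%:Z ^+ k])%Z) ->
  forall k, (s k %% p%:Z ^+ k)%Z
            = ((s k.+1 %% p%:Z ^+ k.+1)%Z %% p%:Z ^+ k)%Z.
Proof. by move=> sP k; rewrite modz_expSm sP. Qed.

Definition padic_reduce (s : nat -> int)
    (sP : forall k, (s k.+1 = s k %[mod p%:Z ^+ k])%Z) : padic p :=
  Padic (padic_reduce_subproof sP).

Lemma resS x k : (res x k.+1 = res x k %[mod p%:Z ^+ k])%Z.
Proof. by rewrite -res_coherent res_mod. Qed.

Lemma padic_int_subproof (n : int) k : (n = n %[mod p%:Z ^+ k])%Z.
Proof. by []. Qed.

Lemma padic_add_subproof x y k :
  (res x k.+1 + res y k.+1 = res x k + res y k %[mod p%:Z ^+ k])%Z.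
Proof. by rewrite -modzDm !resS modzDm. Qed.

Lemma padic_opp_subproof x k : (- res x k.+1 = - res x k %[mod p%:Z ^+ k])%Z.
Proof. by rewrite -modzNm !resS modzNm. Qed.

Lemma padic_mul_subproof x y k :
  (res x k.+1 * res y k.+1 = res x k * res y k %[mod p%:Z ^+ k])%Z.
Proof. by rewrite -modzMm !resS modzMm. Qed.

Definition padic_int (n : int) := padic_reduce (padic_int_subproof n).
Definition padic_add x y := padic_reduce (padic_add_subproof x y).
Definition padic_opp x := padic_reduce (padic_opp_subproof x).
Definition padic_mul x y := padic_reduce (padic_mul_subproof x y).

Lemma padic_addA : associative padic_add.
Proof.
by move=> x y z; apply: padicP => k /=; rewrite modzDmr modzDml addrA.
Qed.
Lemma padic_addC : commutative padic_add.
Proof. by move=> x y; apply: padicP => k /=; rewrite addrC. Qed.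
Lemma padic_add0 : left_id (padic_int 0) padic_add.
Proof. by move=> x; apply: padicP => k /=; rewrite mod0z add0r res_mod. Qed.
Lemma padic_addN : left_inverse (padic_int 0) padic_opp padic_add.
Proof. by move=> x; apply: padicP => k /=; rewrite modzDml addNr. Qed.

HB.instance Definition _ :=
  GRing.isZmodule.Build (padic p) padic_addA padic_addC padic_add0 padic_addN.

Lemma padic_mulA : associative padic_mul.
Proof.
by move=> x y z; apply: padicP => k /=; rewrite modzMmr modzMml mulrA.
Qed.
Lemma padic_mulC : commutative padic_mul.
Proof. by move=> x y; apply: padicP => k /=; rewrite mulrC. Qed.
Lemma padic_mul1 : left_id (padic_int 1) padic_mul.
Proof. by move=> x; apply: padicP => k /=; rewrite modzMml mul1r res_mod. Qed.
Lemma padic_mulD : left_distributive padic_mul padic_add.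
Proof.
by move=> x y z; apply: padicP => k /=; rewrite modzMml modzDm mulrDl.
Qed.

HB.instance Definition _ := GRing.Zmodule_isComPzRing.Build (padic p)
  padic_mulA padic_mulC padic_mul1 padic_mulD.

Lemma res_add x y k : res (x + y) k = ((res x k + res y k) %% p%:Z ^+ k)%Z.
Proof. by []. Qed.

Lemma res_opp x k : res (- x) k = ((- res x k) %% p%:Z ^+ k)%Z.
Proof. by []. Qed.

Lemma res_mul x y k : res (x * y) k = ((res x k * res y k) %% p%:Z ^+ k)%Z.
Proof. by []. Qed.

Lemma res_nat (n : nat) k : res (n%:R : padic p) k = (n%:Z %% p%:Z ^+ k)%Z.
Proof.
elim: n => [//|n IH].
by rewrite mulrSr res_add IH modzDm -addn1 PoszD.
Qed.

Lemma res_int (n : int) k : res (n%:~R : padic p) k = (n %% p%:Z ^+ k)%Z.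
Proof.
case: n => n; first exact: res_nat.
by rewrite NegzE mulrNz res_opp res_nat modzNm.
Qed.

Lemma divz_modM (m : int) k :
  ((m %% p%:Z ^+ k.+1)%Z %/ p)%Z = ((m %/ p)%Z %% p%:Z ^+ k)%Z.
Proof.
have [->|p0] := eqVneq p 0%N; first by rewrite !divz0 mod0z.
have pZ : p%:Z != 0 by [].
have pk : 0 < p%:Z ^+ k by rewrite exprn_gt0 // ltz_nat lt0n.
rewrite {1}/modz exprSr -mulNr mulrA addrC divzMDl // addrC mulNr.
by rewrite /modz [p%:Z ^+ k * p]mulrC divzMA_ge0 // 1?mulrC.
Qed.

Lemma padic_divp_subproof x k :
  (res x k.+1 %/ p)%Z = ((res x k.+2 %/ p)%Z %% p%:Z ^+ k)%Z.
Proof. by rewrite -divz_modM -res_coherent. Qed.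

(* The quotient x / p for x in p Z_p (see padic_divpK and mulp_padic_inj); in
   general the quotient of the Euclidean division by p. *)
Definition padic_divp x : padic p :=
  Padic (fun k => padic_divp_subproof x k).

Lemma padic_divpK x : res x 1 = 0 -> p%:R * padic_divp x = x.
Proof.
move=> x0; apply: padicP => k; rewrite res_mul res_nat modzMml /=.
have res1 j : (res x j.+1 %% p%:Z)%Z = res x 1.
  elim: j => [|j <-]; first by rewrite -[in RHS](res_mod x 1) expr1.
  rewrite [res x j.+1]res_coherent.
  rewrite [(res x j.+2 %% p%:Z ^+ j.+1)%Z]/modz exprSr -mulNr mulrA addrC.
  by rewrite modzMDl.
rewrite mulrC divzK; first by rewrite -res_coherent.
by apply/dvdz_mod0P; rewrite res1.
Qed.

Lemma mulp_padic_inj : (0 < p)%N -> injective (fun x => p%:R * x).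
Proof.
move=> p0 x y E; apply: padicP => k; rewrite (res_coherent x) (res_coherent y).
have := congr1 (fun z : padic p => res z k.+1) E; rewrite !res_mul !res_nat !modzMml.
rewrite exprS => /eqP; rewrite eqz_mod_dvd -mulrBr dvdz_mul2l; last first.
  by rewrite eqz_nat -lt0n.
by rewrite -eqz_mod_dvd => /eqP.
Qed.

End PadicRing.

Section Series.
Variable p : nat.

(* Convergence for the p-adic topology, i.e. the inverse limit of the discrete
   topologies on the rings Z/p^kZ. *)
Definition padic_cvg (s : nat -> padic p) (l : padic p) : Prop :=
  forall k, exists N, forall n, (N <= n)%N -> res (s n) k = res l k.

(* The sum of the series of general term t; 0 if the series diverges. *)
Definition padic_series (t : nat -> padic p) : padic p :=
  xget 0 [set l | padic_cvg (fun n => \sum_(i < n) t i) l]%classic.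

Lemma padic_cvg_unique (s : nat -> padic p) l l' :
  padic_cvg s l -> padic_cvg s l' -> l = l'.
Proof.
move=> sl sl'; apply: padicP => k.
have [N NP] := sl k; have [M MP] := sl' k.
by rewrite -(NP (maxn N M)) ?leq_maxl // MP // leq_maxr.
Qed.

Lemma padic_series_eq (t : nat -> padic p) l :
  padic_cvg (fun n => \sum_(i < n) t i) l -> padic_series t = l.
Proof. by move=> tl; apply: (padic_cvg_unique _ tl); apply: xgetI tl. Qed.

End Series.

Section Collatz.
Variables (p : nat) (a b : p.-tuple int).

Definition mod_p (n : int) : nat := `|(n %% p%:Z)%Z|%N.
Definition padic_mod_p (n : padic p) : nat := `|res n 1|%N.

(* Both divisions by p, in f_int and in f_padic, are exact as soon as
   p %| i * a_i + b_i for every i < p. *)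
Definition f_int (n : int) : int :=
  let i := mod_p n in ((a`_i * n + b`_i) %/ p%:Z)%Z.

Definition f_padic (n : padic p) : padic p :=
  let i := padic_mod_p n in padic_divp ((a`_i)%:~R * n + (b`_i)%:~R).

Definition x_int (i : nat) (n : int) : nat := mod_p (iter i f_int n).
Definition x_padic (i : nat) (n : padic p) : nat :=
  padic_mod_p (iter i f_padic n).

Definition C_graph (k : nat) : digraph :=
  @Digraph 'I_(p ^ k) (fun u v => exists u1 v1 : int,
    [/\ (u1 = u%:Z %[mod (p ^ k)%N%:Z])%Z,
        (v1 = v%:Z %[mod (p ^ k)%N%:Z])%Z & f_int u1 = v1]).

Definition C_graph_padic : digraph :=
  @Digraph (padic p) (fun n m => m = f_padic n).

Lemma Phi_subproof (k : nat) (n : 'I_(p ^ k)) :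
  (\sum_(i < k) x_int i n%:Z * p ^ i < p ^ k)%N.
Proof.
case: k n => [|k] n; first by rewrite big_ord0.
have p0 : (0 < p)%N.
  by have := leq_ltn_trans (leq0n n) (ltn_ord n); rewrite expn_gt0 orbF.
move: (n : int) => m; elim: (k.+1) => [|j IH]; first by rewrite big_ord0.
rewrite big_ord_recr /= expnS.
apply: (@leq_trans (p ^ j + x_int j m * p ^ j)%N).
  by rewrite ltn_add2r.
rewrite -mulSn leq_mul2r; apply/orP; right; rewrite /x_int /mod_p.
by rewrite -ltz_nat gez0_abs ?modz_ge0 ?ltz_pmod // -lt0n.
Qed.

Definition Phi (k : nat) (n : 'I_(p ^ k)) : 'I_(p ^ k) :=
  Ordinal (Phi_subproof n).

Definition Phi_padic (n : padic p) : padic p :=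
  padic_series (fun i => (x_padic i n)%:R * p%:R ^+ i).

(* The map f_padic extends f_int. *)
Lemma f_padic_int (n : int) :
  f_padic (n%:~R : padic p) = (f_int n)%:~R.
Proof.
rewrite /f_padic /f_int /padic_mod_p res_int expr1 -/(mod_p n).
rewrite -intrM -intrD; apply: padicP => k /=.
by rewrite !res_int divz_modM.
Qed.

End Collatz.

Section DeBruijn.
Variable p : nat.

(* The letter of index i in the word c_0 c_1 ... identified with
   n = \sum_i c_i p^i. *)
Definition letter (n i : nat) : nat := ((n %/ p ^ i) %% p)%N.

Lemma letter_sum (k : nat) (n : 'I_(p ^ k)) :
  (\sum_(i < k) letter n i * p ^ i)%N = n.
Proof.
have E m : (\sum_(i < k) letter m i * p ^ i + m %/ p ^ k * p ^ k)%N = m.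
  elim: (k) => [|j IH]; first by rewrite big_ord0 divn1 muln1.
  rewrite big_ord_recr /= -[RHS]IH -addnA; congr addn.
  rewrite /letter expnS mulnA -mulnDl; congr muln.
  by rewrite mulnC [(p * p ^ j)%N]mulnC divnMA mulnC addnC -divn_eq.
by rewrite -[RHS]E divn_small // addn0.
Qed.

Definition B_graph (k : nat) : digraph :=
  @Digraph 'I_(p ^ k) (fun u v =>
    forall i, (i.+1 < k)%N -> letter u i.+1 = letter v i).

Definition shift (n : padic p) : padic p :=
  padic_divp (n - (padic_mod_p n)%:R).

Definition B_graph_padic : digraph :=
  @Digraph (padic p) (fun n m => m = shift n).

End DeBruijn.

(* Main.v *)
Require Import Defs.
From HB Require Import structures.
From mathcomp Require Import all_boot all_order all_algebra ring.
From mathcomp Require Import boolp classical_sets.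

Set Implicit Arguments.
Unset Strict Implicit.
Unset Printing Implicit Defensive.

Import Order.TTheory GRing.Theory Num.Theory.
Local Open Scope ring_scope.

(** If n = i mod p then p * f(n) = a_i n + b_i with a_i prime to p; hence, for
    m = n mod p, f(m) = f(n) mod p^k iff m = n mod p^(k+1).  By induction, m and
    n agree mod p^k iff the first k digits x_i(m) and x_i(n) agree, so Phi_k is
    injective, hence bijective, on residues.  As x_(i+1)(n) = x_i(f(n)), edges
    u -> v of B(p, k+1) correspond to f(u) = v mod p^k, and such a congruence
    lifts to one mod p^(k+1) on changing u by a multiple of p^(k+1).  The
    residue mod p^k of Phi(n) depends only on that of n, so the p-adic statement
    follows by passing to the limit. *)

Lemma PoszX (m k : nat) : (m ^ k)%N%:Z = m%:Z ^+ k.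
Proof. by rewrite -[LHS]natz natrX natz. Qed.

Lemma res_le (p : nat) (x : padic p) (k n : nat) :
  (k <= n)%N -> res x k = (res x n %% p%:Z ^+ k)%Z.
Proof.
move=> /subnK <-; elim: (n - k)%N => [|j IH]; first by rewrite res_mod.
rewrite IH [res x (j + k)]res_coherent addSn.
apply/eqP; rewrite eqz_mod_dvd; apply: (@dvdz_trans (p%:Z ^+ (j + k))).
  by rewrite exprD dvdz_mull.
by rewrite -eqz_mod_dvd modz_mod.
Qed.

Lemma padic_mod_pE (p : nat) (x : padic p) (k : nat) :
  padic_mod_p x = mod_p p (res x k.+1).
Proof. by rewrite /padic_mod_p (@res_le _ x 1 k.+1). Qed.

(** * Digit expansions along the orbit of an integer *)

Section DigitSum.
Variables (p : nat) (a b : p.-tuple int).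
Hypothesis p_gt1 : (2 <= p)%N.

Let p_gt0 : (0 < p)%N. Proof. exact: ltnW. Qed.
Let pZ_neq0 : p%:Z != 0. Proof. by rewrite eqz_nat -lt0n. Qed.
Let pX_gt0 k : 0 < p%:Z ^+ k. Proof. by rewrite exprn_gt0 // ltz_nat. Qed.

Lemma mod_pE m : (mod_p p m)%:Z = (m %% p)%Z.
Proof. by rewrite /mod_p gez0_abs // modz_ge0. Qed.

Lemma mod_p_lt m : (mod_p p m < p)%N.
Proof. by rewrite -ltz_nat mod_pE ltz_pmod. Qed.

Lemma mod_p_eqmod k m n :
  (m = n %[mod p%:Z ^+ k.+1])%Z -> mod_p p m = mod_p p n.
Proof.
move=> /eqP; rewrite eqz_mod_dvd exprSr => /(dvdz_trans (dvdz_mull _ (dvdzz _))).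
by rewrite -eqz_mod_dvd => /eqP E; apply/eqP; rewrite -eqz_nat !mod_pE E.
Qed.

(** The formula of [Phi] on all of Z, so that it can be evaluated at [f_int a b m], which may leave
    {0, ..., p^k - 1}. *)
Definition digit_sum (k : nat) (m : int) : nat :=
  (\sum_(i < k) x_int a b i m * p ^ i)%N.

Lemma digit_sumS k m :
  digit_sum k.+1 m = (mod_p p m + p * digit_sum k (f_int a b m))%N.
Proof.
rewrite /digit_sum big_ord_recl muln1 big_distrr; congr addn.
apply: eq_bigr => i _.
by rewrite /x_int lift0 iterSr expnS mulnCA.
Qed.

Lemma digit_sum_lt k m : (digit_sum k m < p ^ k)%N.
Proof.
elim: k m => [|k IH] m; first by rewrite /digit_sum big_ord0.
rewrite digit_sumS expnS.
apply: (@leq_trans (p + p * digit_sum k (f_int a b m))%N).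
  by rewrite ltn_add2r mod_p_lt.
by rewrite -mulnS leq_mul2l IH orbT.
Qed.

Lemma letter_digit_sum k m i :
  (i < k)%N -> letter p (digit_sum k m) i = x_int a b i m.
Proof.
rewrite /letter; elim: k m i => // k IH m [|i] ik; rewrite digit_sumS.
  by rewrite divn1 mulnC addnC modnMDl modn_small ?mod_p_lt.
rewrite expnS divnMA mulnC addnC divnMDl //.
rewrite [X in (_ + X)%N]divn_small ?mod_p_lt // addn0.
by rewrite IH // /x_int iterSr.
Qed.

Lemma digit_sum_modn k m : (digit_sum k.+1 m %% p ^ k)%N = digit_sum k m.
Proof.
rewrite {1}/digit_sum big_ord_recr /= addnC modnMDl.
by rewrite modn_small // digit_sum_lt.
Qed.

(** * Congruences under one step of f *)

Hypothesis ab : forall i : 'I_p,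
  (p%:Z %| i%:Z * a`_i + b`_i)%Z /\ gcdz a`_i p%:Z = 1.

Lemma coprimez_slope m : coprimez p a`_(mod_p p m).
Proof.
by have [_ /eqP] := ab (Ordinal (mod_p_lt m)); rewrite coprimez_sym.
Qed.

Lemma mulp_f_int m :
  p%:Z * f_int a b m = a`_(mod_p p m) * m + b`_(mod_p p m).
Proof.
rewrite mulrC divzK //; have [+ _] := ab (Ordinal (mod_p_lt m)).
(* Writing m = q p + i reduces divisibility to that of i a_i + b_i. *)
rewrite [X in (_ -> _ %| _ * X + _)%Z](divz_eq m p) /= -mod_pE => i_dvd.
by rewrite mulrDr mulrA -addrA [_ * (mod_p _ _)%:Z]mulrC rpredD // dvdz_mull.
Qed.

(** Equal residues select the same branch, so p (f(m) - f(n)) = a_i (m - n) with a_i prime to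
    p^(k+1). *)
Lemma f_int_eqmod k m n : mod_p p m = mod_p p n ->
  (f_int a b m == f_int a b n %[mod p%:Z ^+ k])%Z
  = (m == n %[mod p%:Z ^+ k.+1])%Z.
Proof.
move=> E; rewrite !eqz_mod_dvd -(@dvdz_mul2l p%:Z) // -exprS mulrBr.
rewrite !mulp_f_int E opprD addrACA subrr addr0 -mulrBr Gauss_dvdzr //.
exact/coprimezXl/coprimez_slope.
Qed.

Lemma digit_sum_eqmod k m n :
  (digit_sum k m == digit_sum k n) = (m == n %[mod p%:Z ^+ k])%Z.
Proof.
elim: k m n => [|k IH] m n.
  by rewrite /digit_sum !big_ord0 expr0 !modz1 !eqxx.
have [E|E] := eqVneq (mod_p p m) (mod_p p n).
  by rewrite !digit_sumS E eqn_add2l eqn_mul2l gtn_eqF // IH f_int_eqmod.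
(* For distinct residues mod p both sides are false: the lowest digits of the two sums already
   differ. *)
have -> : (m == n %[mod p%:Z ^+ k.+1])%Z = false.
  by apply: contra_neqF E => /eqP /mod_p_eqmod.
apply: contra_neqF E => /eqP /(congr1 (modn^~ p)); rewrite !digit_sumS.
rewrite ![(mod_p _ _ + _)%N]addnC ![(p * _)%N]mulnC !modnMDl.
by rewrite !modn_small ?mod_p_lt.
Qed.

Lemma x_int_eqmod k i m n :
  (m = n %[mod p%:Z ^+ k])%Z -> (i < k)%N -> x_int a b i m = x_int a b i n.
Proof.
move=> /eqP; rewrite -digit_sum_eqmod => /eqP E ik.
by rewrite -!(letter_digit_sum _ ik) E.
Qed.

(** * The finite graphs *)

Lemma val_Phi k (n : 'I_(p ^ k)) : Phi a b n = digit_sum k n :> nat.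
Proof. by []. Qed.

Lemma Phi_inj k : injective (@Phi p a b k).
Proof.
move=> u v /(congr1 val) /= /eqP; rewrite digit_sum_eqmod -PoszX !modz_nat.
by rewrite !modn_small // eqz_nat => /eqP /val_inj.
Qed.

Lemma f_int_lift k m n : (f_int a b m = n %[mod p%:Z ^+ k])%Z ->
  exists2 m', (m' = m %[mod p%:Z ^+ k.+1])%Z
            & (f_int a b m' = n %[mod p%:Z ^+ k.+1])%Z.
Proof.
move=> /eqP; rewrite eqz_mod_dvd => /dvdzP[s sE].
have /coprimezP[[u v] /= uv] := coprimez_slope m.
(* [v] inverts the slope modulo [p], so this shift of [m] cancels the error
   [s * p ^+ k] in [f_int m] modulo [p ^+ k.+1]. *)
pose m' := m - s * v * p%:Z ^+ k.+1.
have m'E : (m' = m %[mod p%:Z ^+ k.+1])%Z.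
  by rewrite /m' addrC -mulNr modzMDl.
exists m' => //; apply/eqP; rewrite eqz_mod_dvd -(@dvdz_mul2l p%:Z) //.
apply/dvdzP; exists (s * u); rewrite mulrBr mulp_f_int (mod_p_eqmod m'E).
have -> : n = f_int a b m - s * p%:Z ^+ k by rewrite -sE opprB addrC subrK.
rewrite [p%:Z * (_ - _)]mulrBr mulp_f_int /m' exprS.
transitivity (s * (1 - v * a`_(mod_p p m)) * (p%:Z * p%:Z ^+ k)).
  by ring.
by rewrite -uv; ring.
Qed.

Lemma Phi_edge k (u v : 'I_(p ^ k.+1)) :
  @edge (C_graph a b k.+1) u v <->
  @edge (B_graph p k.+1) (Phi a b u) (Phi a b v).
Proof.
(* Adjacency compares only k pairs of letters: it says that f(u) and v have the same first k
   digits. *)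
have BE : @edge (B_graph p k.+1) (Phi a b u) (Phi a b v) <->
    (f_int a b u = v%:Z %[mod p%:Z ^+ k])%Z.
  split=> [uv|uv i ik].
    apply/eqP; rewrite -digit_sum_eqmod; apply/eqP/eq_bigr => i _.
    have := uv i (ltn_ord i).
    rewrite !val_Phi !letter_digit_sum ?ltnS // 1?ltnW //.
    by rewrite /x_int iterSr => ->.
  rewrite !val_Phi !letter_digit_sum ?ltnS // 1?ltnW // /x_int iterSr.
  exact: x_int_eqmod uv ik.
(* An edge of [C_graph] asks for agreement mod p^(k+1), one power more than [BE] gives; [f_int_lift]
   recovers it. *)
rewrite BE /= PoszX; split=> [[u1 [v1 [uE vE fE]]]|/f_int_lift[u1 uE vE]].
  move: vE => /(congr1 (fun r => r %% p%:Z ^+ k)%Z); rewrite !modz_expSm => <-.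
  apply/eqP; rewrite -fE f_int_eqmod; first by rewrite uE.
  exact/esym/(mod_p_eqmod uE).
by exists u1, (f_int a b u1).
Qed.

Lemma Phi_iso k : (1 <= k)%N ->
  digraph_iso (G := C_graph a b k) (H := B_graph p k) (@Phi p a b k).
Proof.
by case: k => // k _; split=> [|u v]; [exact/injF_bij/Phi_inj|exact: Phi_edge].
Qed.

(** * Passage to the p-adic integers *)

Lemma res_f_padic x k :
  res (f_padic a b x) k = (f_int a b (res x k.+1) %% p%:Z ^+ k)%Z.
Proof.
rewrite /f_int -(padic_mod_pE x k) -divz_modM /f_padic.
rewrite -[LHS]/(res _ k.+1 %/ p)%Z res_add res_mul !res_int.
by rewrite modzMml modzDm.
Qed.

(** Each application of f uses up one power of p, so i and k decrease together in the induction. *)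
Lemma x_padicE x i k :
  (i < k)%N -> x_padic a b i x = x_int a b i (res x k).
Proof.
elim: i k x => [|i IH] [|k] x // ik; first exact: padic_mod_pE.
rewrite /x_padic /x_int !iterSr -/(x_padic a b i _) -/(x_int a b i _) (IH k) //.
by apply: (@x_int_eqmod k) => //; rewrite res_f_padic modz_mod.
Qed.

Lemma res_Phi_padic x k : res (Phi_padic a b x) k = digit_sum k (res x k).
Proof.
pose s k := (digit_sum k (res x k))%:Z.
have sP j : s j = (s j.+1 %% p%:Z ^+ j)%Z.
  rewrite -PoszX modz_nat digit_sum_modn; congr Posz; apply/eqP.
  by rewrite digit_sum_eqmod resS.
suff -> : Phi_padic a b x = Padic sP by [].
(* The first n terms sum to the image of [digit_sum n (res x n)], whose residue mod p^j is that of
   the limit once n >= j. *)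
apply: padic_series_eq => j; exists j => n jn.
rewrite (res_le (Padic sP) jn) /= -res_nat; congr (res _ j).
rewrite /digit_sum natr_sum; apply: eq_bigr => i _.
by rewrite (x_padicE x (ltn_ord i)) natrM natrX.
Qed.

Lemma Phi_padic_inj : injective (Phi_padic a b).
Proof.
move=> x y E; apply: padicP => k; have := congr1 (fun z => res z k) E.
rewrite /= !res_Phi_padic => -[/eqP].
by rewrite digit_sum_eqmod !res_mod => /eqP.
Qed.

Lemma Phi_padic_surj y : exists x, Phi_padic a b x = y.
Proof.
(* At each level k the finite bijection gives a preimage, taken in {0, ..., p^k - 1}. *)
have /choice[s sP] k : exists m : int,
    (m %% p%:Z ^+ k)%Z = m /\ digit_sum k m = res y k :> int.
  have [Psi _ PsiK] := injF_bij (@Phi_inj k).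
  have y_lt : (`|res y k| < p ^ k)%N.
    rewrite -ltz_nat PoszX -(res_mod y k) gez0_abs ?modz_ge0 ?ltz_pmod //.
    exact: lt0r_neq0.
  exists (Psi (Ordinal y_lt)); split.
    by rewrite -PoszX modz_nat modn_small.
  rewrite -val_Phi PsiK /= gez0_abs // -(res_mod y k) modz_ge0 //.
  exact: lt0r_neq0.
(* Preimages are unique mod p^k, hence coherent. *)
have sC k : s k = (s k.+1 %% p%:Z ^+ k)%Z.
  have [smod sk] := sP k; have [_ sk1] := sP k.+1.
  rewrite -{1}smod; apply/eqP; rewrite -digit_sum_eqmod.
  rewrite -(digit_sum_modn k (s k.+1)) -eqz_nat.
  by rewrite sk -modz_nat sk1 PoszX -res_coherent.
exists (Padic sC); apply: padicP => k; rewrite res_Phi_padic /=.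
by case: (sP k).
Qed.

Lemma Phi_padic_bij : bijective (Phi_padic a b).
Proof.
have [Psi PsiK] := choice Phi_padic_surj.
by exists Psi => // x; apply: Phi_padic_inj; rewrite PsiK.
Qed.

(** Yields both the edge condition and the conjugation formula. *)
Lemma Phi_padic_shift x :
  Phi_padic a b (f_padic a b x) = shift (Phi_padic a b x).
Proof.
apply: padicP => k; rewrite res_Phi_padic.
rewrite -[RHS]/(res _ k.+1 %/ p)%Z res_add res_opp res_nat.
rewrite (padic_mod_pE _ k) res_Phi_padic modzNm modzDmr divz_modM.
(* The lowest digit of the sum is m mod p; removing it leaves, by [digit_sumS], p times the digit
   sum of f(m). *)
have -> m : mod_p p (digit_sum k.+1 m) = mod_p p m.
  rewrite /mod_p modz_nat absz_nat digit_sumS addnC mulnC modnMDl modn_small //.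
  exact: mod_p_lt.
rewrite digit_sumS PoszD PoszM addrAC subrr add0r mulrC mulzK //.
rewrite -PoszX modz_nat modn_small ?digit_sum_lt //; congr Posz; apply/eqP.
by rewrite digit_sum_eqmod res_f_padic modz_mod.
Qed.

Lemma Phi_padic_iso :
  digraph_iso (G := C_graph_padic a b) (H := B_graph_padic p) (Phi_padic a b).
Proof.
split=> [|u v] /=; first exact: Phi_padic_bij.
by rewrite -Phi_padic_shift; split=> [->|/Phi_padic_inj].
Qed.

End DigitSum.

Theorem theorem4 (p : nat) (a b : p.-tuple int) :
  (2 <= p)%N ->
  (forall i : 'I_p, (p%:Z %| i%:Z * a`_i + b`_i)%Z /\ gcdz a`_i p%:Z = 1) ->
  (forall k : nat, (1 <= k)%N ->
     isomorphic (C_graph a b k) (B_graph p k) /\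
     digraph_iso (G := C_graph a b k) (H := B_graph p k) (@Phi p a b k)) /\
  isomorphic (C_graph_padic a b) (B_graph_padic p) /\
  digraph_iso (G := C_graph_padic a b) (H := B_graph_padic p)
    (Phi_padic a b) /\
  exists Psi : padic p -> padic p,
    [/\ cancel (Phi_padic a b) Psi, cancel Psi (Phi_padic a b)
      & f_padic a b =1 Psi \o @shift p \o Phi_padic a b].
Proof.
move=> p_gt1 ab; have iso := Phi_padic_iso p_gt1 ab.
split=> [k k_gt0|].
  have isok := Phi_iso p_gt1 ab k_gt0.
  by split=> //; exists (@Phi p a b k).
split; first by exists (Phi_padic a b).
split=> //; have [Psi PhiK PsiK] := Phi_padic_bij p_gt1 ab.
by exists Psi; split=> // x /=; rewrite -(Phi_padic_shift p_gt1 ab) PhiK.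
Qed.
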